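(* Let $C_1,\ldots,C_m\subseteq\mathcal{E}$ be closed convex sets with $C:=\bigcap_{i=1}^m C_i\neq\emptyset$. Given $x^0\in\mathcal{E}$, relaxation parameters $\alpha_i^k\in[0,2)$ and weights $\lambda_i^k\ge0$ with $\sum_{i=1}^m\lambda_i^k=1$ for all $k$, let $\{x^k\}$ be generated by $$x^{k+1}=\sum_{i=1}^m\lambda_i^k\big[(1-\alpha_i^k)x^k+\alpha_i^kP_{C_i}(x^k)\big],\qquad k\ge0.$$ Suppose that one of the following holds: (i) there exist some $\tau>0$ and indices $m(k)\in M(k)$ such that $\mu_{m(k)}^k\ge\tau$ for all $k$; (ii) $\alpha_i^k\in[\alpha_1,\alpha_2]$ for all $i$ and $k$ with some $0<\alpha_1\le\alpha_2<2$, and there exist $\sigma\in(0,1]$ and an integer $s\ge1$ such that for all $k$, $I_\sigma(k)\cup I_\sigma(k+1)\cup\cdots\cup I_\sigma(k+s-1)=\{1,2,\ldots,m\}$. If $C_1,\ldots,C_m$ satisfy a H\''olderian error bound, then $\{x^k\}$ converges to some point in $C$ at least with a sublinear rate $O(k^{-p})$ for some $p>0$, i.e. $\mathrm{dist}(x^k,C)=O(k^{-p})$. In particular, if the H\''olderian error bound is uniform with exponent $\gamma\in(0,1]$, then there exist $M>0$ and $\theta\in(0,1)$ such that for any $k\ge2s$ (for any $k\ge2$ if (i) holds), $$\mathrm{dist}(x^k,C)\le\begin{cases}M\,k^{-\frac{1}{2(\gamma^{-1}-1)}}&\text{if }\gamma\in(0,1),\\ M\,\theta^k&\text{if }\ga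mma=1.\end{cases}$$
   Context: $\mathcal{E}$ is a finite-dimensional real vector space with norm $\|\cdot\|$ induced by an inner product; for a nonempty closed convex set $D$, $\mathrm{dist}(x,D)=\min_{y\in D}\|x-y\|$ and $P_D$ is the orthogonal projection onto $D$. Notation: $M(k):=\mathop{\mathrm{Arg\,max}}_{1\le i\le m}\mathrm{dist}(x^k,C_i)$ (the set of indices attaining the maximum), $I_\sigma(k):=\{i:\lambda_i^k\ge\sigma\}$, and $\mu_i^k:=\alpha_i^k\lambda_i^k\big(2-\sum_{j=1}^m\alpha_j^k\lambda_j^k\big)$. $C_1,\ldots,C_m$ satisfy a H\''olderian error bound if for every bounded set $B\subseteq\mathcal{E}$ there exist $\theta_B>0$ and an exponent $\gamma_B\in(0,1]$ such that $\mathrm{dist}(x,C)\le\theta_B\max_{1\le i\le m}\mathrm{dist}(x,C_i)^{\gamma_B}$ for all $x\in B$. If the same exponent $\gamma_B=\gamma\in(0,1]$ can be taken for all $B$, the bound is uniform (with exponent $\gamma$). *)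

(* Defs.v *)
From HB Require Import structures.
From mathcomp Require Export all_boot all_order all_algebra.
From mathcomp Require Export all_classical all_reals all_analysis.

Set Implicit Arguments.
Unset Strict Implicit.
Unset Printing Implicit Defensive.

Import Order.TTheory GRing.Theory Num.Theory.
Export numFieldNormedType.Exports.

Local Open Scope classical_set_scope.
Local Open Scope ring_scope.

#[short(type="finNormedModType")]
HB.structure Definition FinNormedModule (R : numDomainType) :=
  {E of NormedModule R E & Vector R E}.

(* {dot E for idfun} is the type of symmetric positive definite bilinear
   forms on E. *)
Definition norm_of_dot (R : realType) (E : normedModType R)
    (ip : {dot E for idfun}) : Prop :=
  forall v : E, `|v| = Num.sqrt (ip v v).

Section ConvexFeasibility.
Variables (R : realType) (E : normedModType R).
Implicit Types (D : set E) (x y : E).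

(* The infimum is a minimum when D is nonempty and closed and E is
   finite-dimensional. *)
Definition dist x D : R := inf [set `|x - y| | y in D].

(* The minimiser exists and is unique for D nonempty, closed and convex in a
   finite-dimensional inner product space; the default value x is never used
   there. *)
Definition proj D x : E := xget x [set y | D y /\ `|x - y| = dist x D].

Variable m : nat.
Implicit Types (C : 'I_m -> set E) (xs : nat -> E).
Implicit Types (alpha lambda : nat -> 'I_m -> R).

(* The distances are nonnegative, so the initial value 0 of the iterated
   maximum is harmless. *)
Definition holder_bound_on C (B : set E) (gamma : R) : Prop :=
  exists2 theta : R, 0 < theta &
    forall x, B x -> dist x (\bigcap_i C i) <=
      theta * \big[Num.max/0]_(i < m) (dist x (C i) `^ gamma).

Definition holder_error_bound C : Prop :=
  forall B : set E, bounded_set B ->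
    exists gamma : R, [/\ 0 < gamma, gamma <= 1 & holder_bound_on C B gamma].

Definition uniform_holder_error_bound C (gamma : R) : Prop :=
  forall B : set E, bounded_set B -> holder_bound_on C B gamma.

Definition projection_iterates C alpha lambda (x0 : E) xs : Prop :=
  xs 0%N = x0 /\
  forall k, xs k.+1 =
    \sum_(i < m) lambda k i *:
      ((1 - alpha k i) *: xs k + alpha k i *: proj (C i) (xs k)).

Definition most_remote C xs (k : nat) : set 'I_m :=
  [set i | forall j, dist (xs k) (C j) <= dist (xs k) (C i)].

Definition active (sigma : R) lambda (k : nat) : set 'I_m :=
  [set i | sigma <= lambda k i].

Definition mu alpha lambda (k : nat) (i : 'I_m) : R :=
  alpha k i * lambda k i * (2 - \sum_(j < m) alpha k j * lambda k j).

Definition remotest_control C alpha lambda xs : Prop :=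
  exists (tau : R) (idx : nat -> 'I_m), 0 < tau /\
    forall k, most_remote C xs k (idx k) /\ tau <= mu alpha lambda k (idx k).

Definition intermittent_control alpha lambda (s : nat) : Prop :=
  (exists alpha1 alpha2 : R, [/\ 0 < alpha1, alpha1 <= alpha2, alpha2 < 2 &
     forall k i, alpha1 <= alpha k i <= alpha2]) /\
  (1 <= s)%N /\
  (exists sigma : R, [/\ 0 < sigma, sigma <= 1 &
     forall k, \bigcup_(j in `I_s) active sigma lambda (k + j) = setT]).

Definition holder_rate (gamma M theta : R) (k : nat) : R :=
  if gamma == 1 then M * theta ^+ k
  else M * k%:R `^ (- (1 / (2 * (gamma^-1 - 1)))).

Definition rate_from C xs (gamma : R) (k0 : nat) : Prop :=
  exists M theta : R, [/\ 0 < M, 0 < theta, theta < 1 &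
    forall k, (k0 <= k)%N ->
      dist (xs k) (\bigcap_i C i) <= holder_rate gamma M theta k].

End ConvexFeasibility.

(* Main.v *)
Require Import Defs.
From mathcomp Require Import ring lra zify.

Set Implicit Arguments.
Unset Strict Implicit.
Unset Printing Implicit Defensive.

Import Order.TTheory GRing.Theory Num.Theory.
Import VectorInternalTheory.

Local Open Scope classical_set_scope.
Local Open Scope ring_scope.

(** The argument is quantitative Fejer monotonicity.  Put
    [W := \sum_i alpha_i lambda_i <= 2].  Expanding the square of
    [x_{k+1} - z] for [z] in the intersection, bounding the cross terms by the
    variational inequality of each projection and the squared step by the
    Cauchy-Schwarz inequality, gives [fejer_step]:
    [|x_{k+1} - z|^2 <= |x_k - z|^2 - \sum_i mu_i dist(x_k, C_i)^2].

    Both control rules turn this into one statement, [block_decrease]: for some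
    [s >= 1] and [c > 0], over any [s] consecutive steps the squared distance
    to [z] drops by at least [c * dist(x_k, C_i)^2], for every [i].  For the
    remotest-set rule [s = 1] and the most distant set does the job.  For the
    intermittent rule, [C_i] is activated at some time [k + j] with [j < s];
    moving back from [k + j] to [k] changes the distance to [C_i] only by the
    lengths of the steps taken, and those are themselves paid for by the
    decrease.

    Taking for [z] the projection of [x_k] onto the intersection and inserting
    the error bound, [d_k := dist(x_k, C)] satisfies
    [d_{k+s}^2 <= d_k^2 - kappa * (d_k^2)^(1/gamma)]
    ([holder_recursion]).  This scalar recursion decays geometrically for
    [gamma = 1] and like [n^(-1/q)], with [q = 1/gamma - 1], otherwise
    ([linear_decay], [sublinear_decay]); since [d] is nonincreasing, the rate
    along multiples of [s] extends to all indices ([block_rate]).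

    The error bound is only ever used on the set of iterates, which is bounded,
    so the non-uniform hypothesis provides a single exponent and the same rate.
    Finally [|x_n - x_k| <= 2 d_k] for [n >= k], so that [d_k -> 0] makes the
    sequence Cauchy ([fejer_cvg]); completeness, as well as the existence of
    projections, rests on the compactness of bounded closed sets in finite
    dimension ([bounded_closed_compact_fin]). *)

(** * Inner products *)

Section InnerProduct.
Variables (R : realType) (E : normedModType R) (ip : {dot E for idfun}).
Hypothesis hnorm : norm_of_dot ip.
Implicit Types u v : E.

Lemma dotC u v : ip u v = ip v u.
Proof. by rewrite hermC expr0 mul1r. Qed.

Lemma dot_sqr_norm u : ip u u = `|u| ^+ 2.
Proof.
rewrite hnorm sqr_sqrtr//; have [->|u0] := eqVneq u 0; first by rewrite linear0r.
by rewrite ltW// neq0_dnorm_gt0.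
Qed.

Lemma sqr_normD u v : `|u + v| ^+ 2 = `|u| ^+ 2 + 2 * ip u v + `|v| ^+ 2.
Proof.
by rewrite -!dot_sqr_norm hnormD expr0 mul1r -mulr2n mulr_natl addrAC.
Qed.

End InnerProduct.

(** * Compactness in finite dimension *)

Section FiniteDimension.
Variables (R : realType) (E : finNormedModType R).

Let f : 'rV[R]_(dim E) -> E := @r2v R E.

Let f_continuous : continuous f.
Proof.
have -> : f = fun v : 'rV[R]_(dim E) => \sum_j v 0 j *: f (delta_mx 0 j).
  apply/funext => v; rewrite [in LHS](row_sum_delta v) /f linear_sum.
  by apply: eq_bigr => j _; rewrite linearZ.
apply: continuous_big => [|j _ v]; first exact: add_continuous.
by apply: (@cvgZr_tmp _ _ _ (nbhs v)); exact: coord_continuous.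
Qed.

(** A linear injection is bounded below: its norm attains a positive minimum
    on the compact unit sphere. *)
Let f_lower_bound : exists2 c : R, 0 < c & forall v, c * `|v| <= `|f v|.
Proof.
pose S := [set v : 'rV[R]_(dim E) | `|v| = 1].
(* The unit sphere is empty when the dimension is zero. *)
have [S0|S0] := pselect (S !=set0); last first.
  exists 1 => // v; have [->|v0] := eqVneq v 0; first by rewrite normr0 mulr0.
  case: S0; exists (`|v|^-1 *: v).
  by rewrite /S/= normrZ normfV normr_id mulVf// normr_eq0.
have cS : compact S.
  apply: bounded_closed_compact.
    by exists 1; split=> [|M M1 v /= ->]; [exact: num_real|exact: ltW].
  rewrite (_ : S = (fun v => `|v|) @^-1` [set 1])//.
  by apply: preimage_closed => // v _; exact: norm_continuous.
have [|v0 v0S hv0] := @compact_EVT_min _ R (fun v => `|f v|) S S0 cS.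
  apply: continuous_subspaceT => v.
  by apply: continuous_comp; [exact: f_continuous|exact: norm_continuous].
have v0N : `|v0| = 1 by rewrite inE in v0S.
exists `|f v0|.
  rewrite normr_gt0 /f -(linear0 (@r2v R E)) (inj_eq (@r2v_inj _ _)).
  by rewrite -normr_eq0 v0N oner_neq0.
move=> v; have [->|v0'] := eqVneq v 0; first by rewrite normr0 mulr0.
have nv : 0 < `|v| by rewrite normr_gt0.
have /hv0 : `|v|^-1 *: v \in S.
  by rewrite inE /S/= normrZ normfV normr_id mulVf// normr_eq0.
by rewrite /f linearZ/= normrZ normfV normr_id mulrC ler_pdivlMr.
Qed.

(** A bounded closed set is the image under the coordinate isomorphism of its
    preimage, which is closed by continuity and bounded by the lower bound. *)
Lemma bounded_closed_compact_fin (A : set E) :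
  bounded_set A -> closed A -> compact A.
Proof.
move=> [M [_ hM]] Acl; have [c c0 hc] := f_lower_bound.
have -> : A = f @` (f @^-1` A).
  rewrite image_preimage//; apply/seteqP; split=> // x _.
  by exists (v2r x) => //; rewrite /f v2rK.
apply: continuous_compact; first exact: continuous_subspaceT.
apply: bounded_closed_compact; last first.
  by apply: preimage_closed => // v _; exact: f_continuous.
exists ((M + 1) / c); split=> [|N MN v Av /=]; first exact: num_real.
apply: le_trans (ltW MN); rewrite ler_pdivlMr// mulrC (le_trans (hc v))//.
by apply: hM => //; rewrite ltrDl.
Qed.

End FiniteDimension.

(** * Distances and projections *)

Section Distance.
Variables (R : realType) (E : normedModType R).
Implicit Types (D : set E) (x y : E).

Lemma dist_le D x y : D y -> dist x D <= `|x - y|.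
Proof.
move=> Dy; apply: ge_inf; last by exists y.
by exists 0 => _ [z _ <-].
Qed.

Lemma dist_ge0 D x : D !=set0 -> 0 <= dist x D.
Proof.
move=> [y Dy]; apply: lb_le_inf; first by exists `|x - y|, y.
by move=> _ [z _ <-].
Qed.

Lemma dist_lipschitz D x y : D !=set0 -> dist x D <= `|x - y| + dist y D.
Proof.
move=> [z Dz]; rewrite -lerBlDl; apply: lb_le_inf; first by exists `|y - z|, z.
move=> _ [w Dw <-]; rewrite lerBlDl (le_trans (dist_le _ Dw))//.
by rewrite (le_trans _ (ler_normD _ _))// addrA subrK.
Qed.

End Distance.

Section Projection.
Variables (R : realType) (E : finNormedModType R) (D : set E).
Hypotheses (Dclosed : closed D) (Dne : D !=set0).

(** Only the points of [D] within the distance of some fixed point of [D]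
    compete, and they form a compact set. *)
Lemma dist_attained x : exists y, D y /\ `|x - y| = dist x D.
Proof.
have [y0 Dy0] := Dne.
pose A := D `&` [set y | `|x - y| <= `|x - y0|].
have cont : continuous (fun y : E => `|x - y|).
  move=> y; apply: (@continuous_comp _ _ _ (fun y => x - y) (fun z => `|z|)).
    by apply: cvgB; [exact: cvg_cst|exact: cvg_id].
  exact: norm_continuous.
have [|||y yA hy] := @compact_EVT_min _ R (fun y => `|x - y|) A.
- by exists y0; split=> /=.
- apply: bounded_closed_compact_fin.
    exists (`|x| + `|x - y0|); split=> [|M MM y [_ /= yA]]; first exact: num_real.
    apply: le_trans (ltW MM); rewrite -{1}[y](subKr x).
    by rewrite (le_trans (ler_normB _ _))// lerD2l.
  apply: closedI => //.
  apply: (@preimage_closed _ _ (fun y => `|x - y|) [set r | r <= `|x - y0|]).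
    by move=> y _; exact: cont.
  exact: closed_le.
- exact: continuous_subspaceT.
have [Dy yy0] : A y by rewrite inE in yA.
exists y; split=> //; apply/eqP; rewrite eq_le dist_le// andbT.
apply: lb_le_inf; first by exists `|x - y0|, y0.
move=> _ [z Dz <-]; have [zy|/ltW yz] := leP `|x - z| `|x - y0|.
  by apply: hy; rewrite inE.
exact: le_trans yz.
Qed.

Lemma proj_mem x : D (proj D x).
Proof.
rewrite /proj; case: xgetP => [y _ []//|].
by have [y hy] := dist_attained x => /(_ y).
Qed.

Lemma norm_proj x : `|x - proj D x| = dist x D.
Proof.
rewrite /proj; case: xgetP => [y -> []//|].
by have [y hy] := dist_attained x => /(_ y).
Qed.

Lemma dist_eq0 x : dist x D = 0 -> D x.
Proof.
rewrite -norm_proj => /eqP; rewrite normr_eq0 subr_eq0 => /eqP ->.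
exact: proj_mem.
Qed.

Variable (ip : {dot E for idfun}).
Hypotheses (hnorm : norm_of_dot ip) (Dconvex : convex_set D).

(** Otherwise a short step from the projection towards [z] would stay in [D]
    by convexity and come closer to [x]. *)
Lemma proj_variational x z : D z -> ip (x - proj D x) (z - proj D x) <= 0.
Proof.
move=> Dz; set p := proj D x; rewrite leNgt; apply/negP => h.
set a := ip _ _ in h; set b := `|z - p| ^+ 2.
have b0 : 0 <= b by exact: exprn_ge0.
(* The step t changes the squared distance by t (t b - 2 a), which is negative
   for 0 < t and t b < 2 a; this t also stays below 1, even when b = 0. *)
pose t := a / (a + b).
have t0 : 0 < t by rewrite divr_gt0// ltr_wpDr.
have t1 : t <= 1 by rewrite ler_pdivrMr ?mul1r ?lerDl// ltr_wpDr.
have tab : t * (a + b) = a by rewrite mulfVK// gt_eqF// ltr_wpDr.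
have Dq : D (t *: z + (1 - t) *: p).
  have ti : Itv.spec (@Itv.num_sem R) (Itv.Real `[0%Z, 1%Z]) t.
    by rewrite /= /Itv.num_sem/= num_real/= in_itv/= (ltW t0).
  have := @Dconvex z p (Itv.mk ti).
  rewrite !inE; apply => //; exact: proj_mem.
have := dist_le x Dq; rewrite -norm_proj -/p => hle.
have : `|x - p| ^+ 2 <= `|x - (t *: z + (1 - t) *: p)| ^+ 2.
  by rewrite lerXn2r// nnegrE.
have -> : x - (t *: z + (1 - t) *: p) = (x - p) + (- t) *: (z - p).
  by rewrite scalerBl scale1r addrCA -scalerBr opprD addrA scaleNr.
rewrite (sqr_normD hnorm (x - p)) linearZr_LR/= -/a.
rewrite normrZ normrN exprMn (ger0_norm (ltW t0)) -/b.
nra.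
Qed.

Lemma proj_ip_le x z : D z -> ip (proj D x - x) (x - z) <= - dist x D ^+ 2.
Proof.
move=> /(proj_variational x); rewrite -norm_proj; set p := proj D x.
have -> : z - p = (x - p) - (x - z) by rewrite opprB [RHS]addrC addrA subrK.
rewrite linearB/= (dot_sqr_norm hnorm) -(opprB x p) linearNl; lra.
Qed.

End Projection.

(** * One step of the iteration *)

(** By the triangle inequality this is the scalar Cauchy-Schwarz inequality,
    whose defect is
    [1/2 * \sum_(i, j) w_i w_j (|d_i| - |d_j|)^2]. *)
Lemma sqr_norm_sum_le (R : realType) (E : normedModType R) (I : finType)
    (w : I -> R) (d : I -> E) : (forall i, 0 <= w i) ->
  `|\sum_i w i *: d i| ^+ 2 <= (\sum_i w i) * (\sum_i w i * `|d i| ^+ 2).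
Proof.
move=> w0; apply: (@le_trans _ _ ((\sum_i w i * `|d i|) ^+ 2)).
  rewrite lerXn2r ?nnegrE// ?sumr_ge0// => [i _|]; first exact: mulr_ge0.
  apply: le_trans (ler_norm_sum _ _ _) _.
  by apply: ler_sum => i _; rewrite normrZ ger0_norm.
set S := \sum_i w i * `|d i|; set W := \sum_i w i; set Q := \sum_i _.
suff : S * S + S * S <= W * Q + Q * W by lra.
rewrite /S /W /Q !big_distrlr/= -!big_split/=; apply: ler_sum => i _.
rewrite -!big_split/=; apply: ler_sum => j _.
rewrite -subr_ge0 (_ : _ - _ = w i * w j * (`|d i| - `|d j|) ^+ 2); last by ring.
by rewrite mulr_ge0 ?sqr_ge0// mulr_ge0.
Qed.

Section Iterates.
Variables (R : realType) (E : finNormedModType R) (ip : {dot E for idfun}).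
Variables (m : nat) (C : 'I_m -> set E) (alpha lambda : nat -> 'I_m -> R).
Variables (x0 : E) (x : nat -> E).
Hypotheses (hnorm : norm_of_dot ip)
  (hclosed : forall i, closed (C i)) (hconvex : forall i, convex_set (C i))
  (hne : \bigcap_i C i !=set0)
  (halpha : forall k i, 0 <= alpha k i < 2)
  (hlambda : forall k i, 0 <= lambda k i)
  (hsum : forall k, \sum_(i < m) lambda k i = 1)
  (hx : projection_iterates C alpha lambda x0 x).

Let w k i := alpha k i * lambda k i.
Let W k := \sum_(i < m) w k i.
Let Q k := \sum_(i < m) w k i * dist (x k) (C i) ^+ 2.

Let C_ne i : C i !=set0.
Proof. by have [z Cz] := hne; exists z; exact: Cz. Qed.

Let w_ge0 k i : 0 <= w k i.
Proof. by rewrite mulr_ge0//; have /andP[] := halpha k i. Qed.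

Let Q_ge0 k : 0 <= Q k.
Proof. by rewrite sumr_ge0// => i _; rewrite mulr_ge0 ?sqr_ge0. Qed.

Lemma weight_le (a : R) k : (forall i, alpha k i <= a) -> W k <= a.
Proof.
move=> ha; rewrite -[a]mulr1 -(hsum k) mulr_sumr; apply: ler_sum => i _.
exact: ler_wpM2r.
Qed.

Lemma iterate_step k :
  x k.+1 = x k + \sum_(i < m) w k i *: (proj (C i) (x k) - x k).
Proof.
have [_ ->] := hx.
rewrite -[X in _ = X + _]scale1r -[X in _ = X *: _ + _](hsum k).
rewrite scaler_suml -big_split/=.
apply: eq_bigr => i _; rewrite scalerBl scale1r -addrA scalerDr; congr (_ + _).
by rewrite [- _ + _]addrC -scalerBr scalerA mulrC.
Qed.

Lemma sqr_step_le k : `|x k.+1 - x k| ^+ 2 <= W k * Q k.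
Proof.
rewrite iterate_step addrAC subrr add0r.
rewrite (le_trans (sqr_norm_sum_le _ (w_ge0 k)))//.
apply: ler_wpM2l; first exact: sumr_ge0.
by apply: ler_sum => i _; rewrite distrC norm_proj.
Qed.

(** In the expansion of the square, the cross terms contribute at most [-2 Q]
    and the squared step at most [W * Q]; the difference [(2 - W k) * Q k] is
    the sum of the [mu alpha lambda k i * dist (x k) (C i) ^+ 2]. *)
Lemma fejer_step k z : (\bigcap_i C i) z ->
  `|x k.+1 - z| ^+ 2 <= `|x k - z| ^+ 2 - (2 - W k) * Q k.
Proof.
move=> Cz; have := sqr_step_le k.
rewrite iterate_step; set S := \sum_i _.
rewrite [_ + S]addrC addrK -addrA (addrC S) (sqr_normD hnorm (x k - z)) => hS.
suff : ip (x k - z) S <= - Q k by nra.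
rewrite (dotC ip) /S linear_sumlz /Q -sumrN; apply: ler_sum => i _.
rewrite linearZl_LR/= -mulrN; apply: ler_wpM2l; first exact: w_ge0.
by apply: (proj_ip_le _ _ hnorm) => //; exact: Cz.
Qed.

Let W_le2 k : W k <= 2.
Proof. by apply: weight_le => i; have /andP[_ /ltW] := halpha k i. Qed.

Lemma mu_decrease k z i : (\bigcap_i C i) z ->
  mu alpha lambda k i * dist (x k) (C i) ^+ 2
    <= `|x k - z| ^+ 2 - `|x k.+1 - z| ^+ 2.
Proof.
move=> /(fejer_step k) h.
suff : w k i * dist (x k) (C i) ^+ 2 <= Q k.
  rewrite /mu -/(w k i) -/(W k); have := W_le2 k; nra.
rewrite /Q (bigD1 i)//= lerDl sumr_ge0// => j _.
by rewrite mulr_ge0// sqr_ge0.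
Qed.

Lemma fejer k n z : (\bigcap_i C i) z -> (k <= n)%N -> `|x n - z| <= `|x k - z|.
Proof.
move=> Cz /subnKC <-; elim: (n - k)%N => [|j]; first by rewrite addn0.
apply: le_trans; rewrite -(ler_pXn2r (ltn0Sn 1)) ?nnegrE// addnS.
have := fejer_step (k + j) Cz; have := W_le2 (k + j); have := Q_ge0 (k + j); nra.
Qed.

(** * Decrease over a block of steps *)

Definition block_decrease (s : nat) (c : R) : Prop :=
  forall k z i, (\bigcap_i C i) z ->
    c * dist (x k) (C i) ^+ 2 <= `|x k - z| ^+ 2 - `|x (k + s)%N - z| ^+ 2.

Lemma remotest_block_decrease : remotest_control C alpha lambda x ->
  exists2 c, 0 < c & block_decrease 1 c.
Proof.
move=> [tau [idx [tau0 h]]]; exists tau => // k z i Cz; rewrite addn1.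
have [far mutau] := h k; apply: le_trans (mu_decrease k (idx k) Cz).
apply: (@le_trans _ _ (tau * dist (x k) (C (idx k)) ^+ 2)).
  by rewrite ler_pM2l// lerXn2r ?nnegrE ?dist_ge0.
by rewrite ler_wpM2r// sqr_ge0.
Qed.

(** Along a block, the squared step and, once [C_i] is active, the squared
    distance to [C_i] are both bounded by [K] times the decrease of
    [|x_k - z|^2].  Going back one step at a time from the activation of [C_i],
    the inequality [(a + b)^2 <= 2 a^2 + 2 b^2] doubles the constant, whence
    the factor [2 ^+ j]. *)
Lemma intermittent_block_decrease s : intermittent_control alpha lambda s ->
  exists2 c, 0 < c & block_decrease s c.
Proof.
move=> [[a1 [a2 [a1_gt0 a12 a2_lt2 ha]]] [s1 [sg [sg0 _ hcov]]]].
have wa2 k : W k <= a2 by apply: weight_le => i; have /andP[] := ha k i.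
pose c := a1 * sg * (2 - a2); have c0 : 0 < c by rewrite !mulr_gt0// subr_gt0.
pose K := c^-1 + a2 / (2 - a2).
have a2K : a2 / (2 - a2) <= K by rewrite lerDr invr_ge0 ltW.
have cK : c^-1 <= K.
  by rewrite lerDl divr_ge0 ?subr_ge0 ?(ltW a2_lt2) ?(le_trans (ltW a1_gt0)).
have K0 : 0 < K by apply: lt_le_trans cK; rewrite invr_gt0.
pose e z k := `|x k - z| ^+ 2.
have e_anti z k n : (\bigcap_i C i) z -> (k <= n)%N -> e z n <= e z k.
  by move=> Cz kn; rewrite lerXn2r ?nnegrE// fejer.
have step k z : (\bigcap_i C i) z ->
    `|x k.+1 - x k| ^+ 2 <= K * (e z k - e z k.+1).
  move=> Cz; apply: le_trans (sqr_step_le k) _.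
  apply: (@le_trans _ _ (a2 / (2 - a2) * ((2 - W k) * Q k))).
    rewrite mulrA ler_wpM2r// (le_trans (wa2 k))// mulrAC ler_pdivlMr ?subr_gt0//.
    by rewrite ler_wpM2l// ?(le_trans (ltW a1_gt0))// lerD2l lerN2.
  apply: (@le_trans _ _ (K * ((2 - W k) * Q k))).
    by rewrite ler_wpM2r// mulr_ge0// subr_ge0.
  by rewrite ler_pM2l//; have := fejer_step k Cz; rewrite -/(e z k) -/(e z k.+1); lra.
have near_active j : forall k z i, (\bigcap_i C i) z -> sg <= lambda (k + j) i ->
    dist (x k) (C i) ^+ 2 <= 2 ^+ j * K * (e z k - e z (k + j).+1).
  elim: j => [|j IH] k z i Cz.
    rewrite addn0 mul1r => sgl.
    apply: (@le_trans _ _ (c^-1 * (mu alpha lambda k i * dist (x k) (C i) ^+ 2))).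
      rewrite mulrA ler_peMl ?sqr_ge0// ler_pdivlMl// mulr1 /c.
      rewrite ler_pM ?mulr_ge0 ?subr_ge0 ?(ltW a1_gt0) ?(ltW sg0) ?(ltW a2_lt2)//.
        by rewrite ler_pM ?(ltW a1_gt0) ?(ltW sg0)//; have /andP[] := ha k i.
      by rewrite lerD2l lerN2; exact: wa2.
    apply: (@le_trans _ _ (c^-1 * (e z k - e z k.+1))).
      by rewrite ler_pM2l ?invr_gt0//; exact: mu_decrease.
    by rewrite ler_wpM2r// subr_ge0 e_anti.
  rewrite -addSnnS => /(IH k.+1 z i Cz) {}IH.
  have h1 := @dist_lipschitz _ _ (C i) (x k) (x k.+1) (C_ne i).
  have h2 : 2 ^+ j.+1 * K * (e z k - e z k.+1) >= 2 * (K * (e z k - e z k.+1)).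
    rewrite mulrA ler_wpM2r ?subr_ge0 ?e_anti// ler_pM2r// exprS.
    by rewrite ler_peMr// exprn_ege1// ler1n.
  have h3 := step k z Cz; rewrite distrC in h3.
  apply: (@le_trans _ _ ((`|x k - x k.+1| + dist (x k.+1) (C i)) ^+ 2)).
    by rewrite lerXn2r// nnegrE ?addr_ge0 ?dist_ge0.
  rewrite exprS in h2 *.
  have : (`|x k - x k.+1| - dist (x k.+1) (C i)) ^+ 2 >= 0 by exact: sqr_ge0.
  nra.
have K2 : 0 < 2 ^+ s * K by rewrite mulr_gt0// exprn_gt0.
exists (2 ^+ s * K)^-1 => [|k z i Cz]; first by rewrite invr_gt0.
rewrite ler_pdivrMl//.
have [j js ilam] : exists2 j, (j < s)%N & sg <= lambda (k + j) i.
  by have : [set: 'I_m] i by []; rewrite -(hcov k) => -[j /= js il]; exists j.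
apply: le_trans (near_active j k z i Cz ilam) _.
apply: ler_pM.
- by rewrite mulr_ge0// ?exprn_ge0// ltW.
- by rewrite subr_ge0 e_anti// -addnS leq_addr.
- by rewrite ler_pM2r// ler_weXn2l ?ler1n// ltnW.
- by rewrite lerD2l lerN2 -addnS e_anti// leq_add2l.
Qed.

End Iterates.

(** * Scalar recursions *)

Section Recursion.
Variable R : realType.
Implicit Types (a : nat -> R) (c q p : R).

Lemma ler_powRN p (x y : R) : 0 <= p -> 0 < x -> x <= y ->
  y `^ (- p) <= x `^ (- p).
Proof.
move=> p0 x0 xy; have y0 := lt_le_trans x0 xy.
rewrite !powRN lef_pV2 ?posrE ?powR_gt0//.
by rewrite ge0_ler_powR// nnegrE ltW.
Qed.

(** For [v n := a n `^ q] and [kappa := q * c], the bound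
    [1 - t <= exp (- t)] gives [v n.+1 <= v n * exp (- kappa * v n)], hence
    [v n.+1 <= v n / (1 + kappa * v n)].  As the inverse of [v] then grows by
    at least [kappa] at each step, [kappa * n * v n <= 1]; in this form
    the induction also covers the case [v n = 0]. *)
Lemma sublinear_decay a c q : 0 < c -> 0 < q -> (forall n, 0 <= a n) ->
  (forall n, a n.+1 <= a n - c * a n `^ (1 + q)) ->
  forall n, (0 < n)%N -> a n <= (q * c * n%:R) `^ (- q^-1).
Proof.
move=> c0 q0 a0 ha; pose v n := a n `^ q; pose kappa := q * c.
have kappa0 : 0 < kappa by exact: mulr_gt0.
have v0 n : 0 <= v n by exact: powR_ge0.
have v_step n : v n.+1 * (1 + kappa * v n) <= v n.
  have h1 : a n.+1 <= a n * expR (- (c * v n)).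
    apply: le_trans (ha n) _; have := expR_ge1Dx (- (c * v n)).
    have -> : a n `^ (1 + q) = a n * v n.
      by rewrite powRD ?powRr1// gt_eqF// ltr_wpDr// ltW.
    have := a0 n; nra.
  have h2 : v n.+1 <= v n * expR (- (kappa * v n)).
    apply: (@le_trans _ _ ((a n * expR (- (c * v n))) `^ q)).
      by rewrite ge0_ler_powR// ?nnegrE ?mulr_ge0 ?expR_ge0// ltW.
    rewrite powRM ?expR_ge0// -expRM /v /kappa.
    by rewrite (_ : - (c * _) * q = - (q * c * a n `^ q))//; ring.
  apply: (@le_trans _ _ (v n.+1 * expR (kappa * v n))).
    by rewrite ler_wpM2l// expR_ge1Dx.
  by rewrite expRN ler_pdivlMr ?expR_gt0 in h2.
have v_bound n : kappa * n%:R * v n <= 1.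
  elim: n => [|n IH]; first by rewrite mulr0 mul0r.
  have d0 : 0 < 1 + kappa * v n by rewrite ltr_pwDl// mulr_ge0// ltW.
  rewrite -(ler_pM2r d0) mul1r -[leLHS]mulrA.
  apply: (@le_trans _ _ (kappa * n.+1%:R * v n)).
    by rewrite ler_wpM2l// mulr_ge0// ltW.
  by rewrite -natr1 mulrDr mulr1 mulrDl lerD2r.
move=> n n0; have kn0 : 0 < kappa * n%:R by rewrite mulr_gt0// ltr0n.
have -> : a n = v n `^ q^-1 by rewrite /v -powRrM mulfV ?powRr1// gt_eqF.
rewrite powRN -[leRHS]mul1r ler_pdivlMr ?powR_gt0// -powRM// ?(ltW kn0)//.
have h1 : 1 `^ q^-1 = 1 :> R by rewrite powR1.
rewrite -[leRHS]h1 ge0_ler_powR ?nnegrE ?invr_ge0 ?(ltW q0)//.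
  by rewrite mulr_ge0// ltW.
by rewrite mulrC v_bound.
Qed.

Lemma linear_decay a c : 0 <= c -> (forall n, 0 <= a n) ->
  (forall n, a n.+1 <= a n - c * a n) ->
  forall n, a n <= a 0%N * expR (- (c * n%:R)).
Proof.
move=> c0 a0 ha; elim=> [|n IH]; first by rewrite mulr0 oppr0 expR0 mulr1.
apply: le_trans (ha n) _; rewrite -natr1 mulrDr mulr1 opprD expRD mulrA.
apply: (@le_trans _ _ (a n * expR (- c))).
  by rewrite -[X in X - _]mulr1 [c * _]mulrC -mulrBr ler_wpM2l// expR_ge1Dx.
by rewrite ler_wpM2r ?expR_ge0.
Qed.

(** For [t := - ln theta], [theta ^+ k] is the inverse of [expR (k * t)], which
    is at least [k * t].  Thanks to this comparison the geometric rate of the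
    case [gamma = 1] is also a power rate. *)
Lemma geometric_le_inv (theta : R) k : 0 < theta -> theta < 1 -> (0 < k)%N ->
  theta ^+ k <= (- ln theta)^-1 * k%:R^-1.
Proof.
move=> t0 t1 k0; set t := - ln theta.
have t_gt0 : 0 < t by rewrite oppr_gt0 ln_lt0// t0 t1.
have -> : theta ^+ k = (expR (k%:R * t))^-1.
  by rewrite -expRN -mulrN opprK expRM_natl lnK.
rewrite -invfM lef_pV2 ?posrE ?expR_gt0 ?mulr_gt0 ?ltr0n// mulrC.
by rewrite (le_trans _ (expR_ge1Dx _))// lerDr.
Qed.

End Recursion.

(** * Rates and convergence *)

Section Rates.
Variables (R : realType) (E : finNormedModType R) (m : nat) (C : 'I_m -> set E).
Variable x : nat -> E.
Hypotheses (hclosed : forall i, closed (C i)) (hne : \bigcap_i C i !=set0).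
Hypothesis fejer_mono : forall k n z,
  (\bigcap_i C i) z -> (k <= n)%N -> `|x n - z| <= `|x k - z|.

Let CC := \bigcap_i C i.
Let d k := dist (x k) CC.

Let CC_closed : closed CC.
Proof. by apply: closed_bigI => i _. Qed.

Let d_ge0 k : 0 <= d k.
Proof. exact: dist_ge0. Qed.

Lemma dist_anti k n : (k <= n)%N -> dist (x n) CC <= dist (x k) CC.
Proof.
move=> kn; rewrite -(norm_proj CC_closed hne (x k)).
apply: le_trans (fejer_mono _ kn); last exact: proj_mem CC_closed hne _.
exact: dist_le (proj_mem CC_closed hne _).
Qed.

(** With [z] the projection of [x k] onto the intersection, [block_decrease]
    bounds all the distances [dist (x k) (C i)] by the square root of
    [(d k ^+ 2 - d (k + s) ^+ 2) / c]; the error bound converts this into a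
    bound on [d k]. *)
Lemma holder_recursion (B : set E) (gamma : R) s c :
  0 < gamma -> 0 < c -> block_decrease C x s c ->
  holder_bound_on C B gamma -> (forall k, B (x k)) ->
  exists2 kappa, 0 < kappa & forall k,
    d (k + s)%N ^+ 2 <= d k ^+ 2 - kappa * (d k ^+ 2) `^ gamma^-1.
Proof.
move=> g0 c0 hdec [theta th0 hB] Bx.
exists (c * (theta^-1 `^ gamma^-1) ^+ 2) => [|k].
  by rewrite mulr_gt0// exprn_gt0// powR_gt0// invr_gt0.
set p := proj CC (x k); have CCp : CC p by exact: proj_mem.
have dk : `|x k - p| = d k by exact: norm_proj.
pose delta := c^-1 * (d k ^+ 2 - d (k + s)%N ^+ 2).
have delta0 : 0 <= delta.
  rewrite mulr_ge0 ?invr_ge0 ?(ltW c0)// subr_ge0 lerXn2r ?nnegrE ?d_ge0//.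
  by apply: dist_anti; exact: leq_addr.
have far i : dist (x k) (C i) <= Num.sqrt delta.
  rewrite -[leLHS]ger0_norm; last by apply: dist_ge0; exists p; exact: CCp.
  rewrite -sqrtr_sqr ler_wsqrtr// ler_pdivlMl//.
  apply: le_trans (hdec k p i CCp) _; rewrite dk lerD2l lerN2.
  by rewrite lerXn2r ?nnegrE ?d_ge0// dist_le.
have dtheta : d k * theta^-1 <= Num.sqrt delta `^ gamma.
  rewrite ler_pdivrMr// mulrC; apply: le_trans (hB _ (Bx k)) _.
  rewrite ler_pM2l//; apply: bigmax_le => [|i _]; first exact: powR_ge0.
  rewrite ge0_ler_powR ?nnegrE ?sqrtr_ge0 ?(ltW g0)//.
  by apply: dist_ge0; exists p; exact: CCp.
have droot : (d k * theta^-1) `^ gamma^-1 <= Num.sqrt delta.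
  rewrite -[leRHS]powRr1 ?sqrtr_ge0// -(mulfV (lt0r_neq0 g0)) powRrM.
  rewrite ge0_ler_powR ?nnegrE ?powR_ge0 ?invr_ge0 ?(ltW g0)//.
  by rewrite mulr_ge0 ?d_ge0 ?invr_ge0 ?(ltW th0).
rewrite lerBrDl -lerBrDr -mulrA -ler_pdivlMl// -/delta -(sqr_sqrtr delta0).
rewrite (expr2 (d k)) powRM ?d_ge0// -expr2 -exprMn mulrC.
rewrite -powRM ?d_ge0 ?invr_ge0 ?(ltW th0)//.
by rewrite lerXn2r ?nnegrE ?powR_ge0 ?sqrtr_ge0.
Qed.

(** The recursion controls [d] at the multiples of [s].  For [2 s <= k] the
    quotient [n := k %/ s] satisfies [k / (2 s) <= n], so the rate in [n] is a
    rate in [k] up to a constant. *)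
Lemma block_rate (B : set E) (gamma : R) s c :
  0 < gamma -> gamma <= 1 -> (0 < s)%N -> 0 < c -> block_decrease C x s c ->
  holder_bound_on C B gamma -> (forall k, B (x k)) ->
  rate_from C x gamma (2 * s).
Proof.
move=> g0 g1 s0 c0 hdec hB Bx.
have [kappa kap0 rec] := holder_recursion g0 c0 hdec hB Bx.
pose a n := d (n * s)%N ^+ 2.
have a0 n : 0 <= a n by exact: sqr_ge0.
have rec_a n : a n.+1 <= a n - kappa * a n `^ gamma^-1.
  by rewrite /a mulSn addnC; exact: rec.
pose r : R := 2 * s%:R; have r0 : 0 < r by rewrite mulr_gt0// ltr0n.
have block k : (2 * s <= k)%N -> [/\ (0 < k %/ s)%N, k%:R / r <= (k %/ s)%:R
    & d k ^+ 2 <= a (k %/ s)%N].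
  move=> sk; have n0 : (0 < k %/ s)%N by rewrite divn_gt0//; lia.
  split=> //.
    rewrite ler_pdivrMr// /r -!natrM ler_nat.
    have := divn_eq k s; have := ltn_pmod k s0; nia.
  rewrite lerXn2r ?nnegrE ?d_ge0//; apply: dist_anti.
  by rewrite leq_divM.
have [gE|gN1] := eqVneq gamma 1.
  (* The last factor 2 comes from the square root; the summand 1 below makes the
     constant positive even when d 0 = 0. *)
  pose theta := expR (- (kappa / r / 2)).
  exists (d 0%N + 1), theta; split.
  - by rewrite ltr_wpDl// d_ge0.
  - exact: expR_gt0.
  - by rewrite expR_lt1 oppr_lt0 !divr_gt0.
  move=> k /block[n0 kn da]; rewrite /holder_rate gE eqxx -/(d k).
  have rhs0 : 0 <= (d 0%N + 1) * theta ^+ k.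
    by rewrite mulr_ge0 ?addr_ge0 ?d_ge0// exprn_ge0 ?expR_ge0.
  rewrite -(ler_pXn2r (ltn0Sn 1)) ?nnegrE ?d_ge0// (le_trans da)//.
  apply: le_trans (linear_decay (ltW kap0) a0 _ _) _ => [n|].
    by have := rec_a n; rewrite gE invr1 powRr1.
  rewrite exprMn; apply: ler_pM; rewrite ?expR_ge0//.
    by rewrite /a mul0n lerXn2r ?nnegrE ?addr_ge0 ?d_ge0// lerDl.
  rewrite -exprM -expRM_natl ler_expR mulrN lerN2 natrM.
  have -> : k%:R * 2 * (kappa / r / 2) = kappa * (k%:R / r) by field; exact: lt0r_neq0.
  by rewrite ler_pM2l.
pose q := gamma^-1 - 1.
have q0 : 0 < q by rewrite subr_gt0 invf_gt1// lt_neqAle gN1.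
pose beta := q * kappa / r.
have beta0 : 0 < beta by rewrite divr_gt0// mulr_gt0.
exists (beta `^ (- (1 / (2 * q)))), 2^-1.
split; [exact: powR_gt0|by rewrite invr_gt0|by rewrite invf_lt1 ?ltr1n|].
move=> k k2s; have [n0 kn da] := block k k2s.
have k0 : 0 < k%:R :> R by rewrite ltr0n; lia.
rewrite /holder_rate (negPf gN1) -/q -/(d k) -powRM ?(ltW beta0) ?(ltW k0)//.
rewrite -(ler_pXn2r (ltn0Sn 1)) ?nnegrE ?d_ge0 ?powR_ge0// (le_trans da)//.
apply: le_trans (sublinear_decay kap0 q0 a0 _ n0) _ => [n|].
  by rewrite /q [1 + _]addrC subrK.
rewrite -powR_mulrn ?powR_ge0// -powRrM.
have -> : - (1 / (2 * q)) * 2%:R = - q^-1 by field; exact: lt0r_neq0.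
apply: ler_powRN; first by rewrite invr_ge0 ltW.
  by rewrite mulr_gt0.
by rewrite /beta mulrAC -mulrA ler_pM2l// mulr_gt0.
Qed.

Lemma rate_from_power (gamma : R) k0 : 0 < gamma -> gamma <= 1 ->
  rate_from C x gamma k0 ->
  exists M p : R, [/\ 0 < M, 0 < p & forall k, (k0 < k)%N ->
    d k <= M * k%:R `^ (- p)].
Proof.
move=> g0 g1 [M [theta [M0 t0 t1 h]]].
have [gE|gN1] := eqVneq gamma 1.
  exists (M * (- ln theta)^-1), 1; split=> //.
    by rewrite mulr_gt0// invr_gt0 oppr_gt0 ln_lt0// t0.
  move=> k k0k; apply: le_trans (h k (ltnW k0k)) _.
  rewrite /holder_rate gE eqxx powR_inv1// -mulrA ler_pM2l//.
  by apply: geometric_le_inv => //; exact: leq_ltn_trans k0k.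
exists M, (1 / (2 * (gamma^-1 - 1))); split=> //.
  by rewrite divr_gt0// mulr_gt0// subr_gt0 invf_gt1// lt_neqAle gN1.
move=> k /ltnW k0k; have := h k k0k.
by rewrite /holder_rate (negPf gN1).
Qed.

Lemma power_bigO (M p : R) k0 : 0 < M ->
  (forall k, (k0 < k)%N -> d k <= M * k%:R `^ (- p)) ->
  (fun k => d k : R^o) =O_\oo (fun k => k%:R `^ (- p) : R^o).
Proof.
move=> M0 h; apply/eqO_exP; exists M => //.
near=> k; rewrite ger0_norm ?d_ge0// ger0_norm ?powR_ge0//.
by apply: h; near: k; exact: nbhs_infty_gt.
Unshelve. all: by end_near. Qed.

(** An explicit [k] is at least [(M / e) `^ (1 / p)]. *)
Lemma power_dist_small (M p : R) k0 : 0 < M -> 0 < p ->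
  (forall k, (k0 < k)%N -> d k <= M * k%:R `^ (- p)) ->
  forall e, 0 < e -> exists k, d k <= e.
Proof.
move=> M0 p0 h e e0.
pose y := (M / e) `^ p^-1.
pose k := maxn k0.+1 (Num.trunc y).+1.
have k0k : (k0 < k)%N by rewrite /k leq_max ltnSn.
exists k; apply: le_trans (h k k0k) _.
have y0 : 0 < y by rewrite powR_gt0// divr_gt0.
have yk : y <= k%:R.
  by rewrite (le_trans (ltW (truncnS_gt _)))// ler_nat /k leq_max leqnn orbT.
apply: (@le_trans _ _ (M * y `^ (- p))).
  by rewrite ler_pM2l// ler_powRN// ltW.
rewrite powRN /y -powRrM mulVf ?gt_eqF// powRr1 ?divr_ge0 ?(ltW M0) ?(ltW e0)//.
by rewrite invf_div mulrCA mulfV ?mulr1// lt0r_neq0.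
Qed.

Lemma bounded_iterates : bounded_set (range x).
Proof.
have [z Cz] := hne.
exists (`|x 0%N - z| + `|z|); split=> [|M MM _ [k _ <-] /=]; first exact: num_real.
apply: le_trans (ltW MM); rewrite -{1}[x k](subrK z).
by rewrite (le_trans (ler_normD _ _))// lerD2r fejer_mono.
Qed.

(** From index [k] on, the iterates stay within [d k] of the projection of
    [x k] onto the intersection, hence within [2 * d k] of [x k]. *)
Lemma fejer_cvg : (forall e, 0 < e -> exists k, d k <= e) ->
  exists2 l, CC l & x @ \oo --> l.
Proof.
move=> small.
have [z0 Cz0] := hne.
have close k n : (k <= n)%N -> `|x n - x k| <= 2 * d k.
  move=> kn; rewrite -(subrKA (proj CC (x k))) -(opprB (x k)).
  rewrite (le_trans (ler_normB _ _))// mulr2n mulrDl mul1r.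
  rewrite lerD// /d -(norm_proj CC_closed hne (x k)) //.
  by apply: fejer_mono => //; exact: proj_mem.
have xcauchy : cauchy (x @ \oo).
  apply: cauchy_exP => e e0; have e4 : 0 < e / 4 by rewrite divr_gt0.
  have [k dk] := small (e / 4) e4.
  exists (x k).
  suff : \forall n \near \oo, ball (x k) e (x n) by [].
  near=> n; rewrite -ball_normE /= distrC.
  apply: (@le_lt_trans _ _ (2 * d k)).
    by apply: close; near: n; exact: nbhs_infty_ge.
  lra.
have xcvg : cvg (x @ \oo).
  apply: (@compact_cauchy_cvg _ [set y | `|y - z0| <= `|x 0%N - z0|]) => //.
    by exists 0%N => // n _ /=; exact: fejer_mono.
  apply: bounded_closed_compact_fin.
    exists (`|x 0%N - z0| + `|z0|); split=> [|M MM y /= hy]; first exact: num_real.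
    apply: le_trans (ltW MM); rewrite -{1}[y](subrK z0).
    by rewrite (le_trans (ler_normD _ _))// lerD2r.
  apply: (@preimage_closed _ _ (fun y => `|y - z0|) [set r | r <= `|x 0%N - z0|]).
    move=> y _; apply: (@continuous_comp _ _ _ (fun y => y - z0) (fun z => `|z|)).
      by apply: cvgB; [exact: cvg_id|exact: cvg_cst].
    exact: norm_continuous.
  exact: closed_le.
exists (lim (x @ \oo)); last exact: xcvg.
set l := lim _.
apply: (dist_eq0 CC_closed hne); apply/eqP; rewrite eq_le dist_ge0// andbT.
apply/ler_addgt0Pr => e e0; rewrite add0r.
have e4 : 0 < e / 4 by rewrite divr_gt0.
have [k dk] := small (e / 4) e4.
have [n [kn ln]] : exists n, (k <= n)%N /\ `|l - x n| < e / 4.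
  near \oo => n; exists n; split; first by near: n; exact: nbhs_infty_ge.
  near: n; move/cvgrPdist_lt : xcvg; exact.
have := dist_lipschitz l (x n) hne.
have : d n <= d k by exact: dist_anti.
rewrite /d in dk *; lra.
Unshelve. all: by end_near. Qed.

End Rates.

Theorem corollary4p12 (R : realType) (E : finNormedModType R)
    (ip : {dot E for idfun}) (hnorm : norm_of_dot ip)
    (m : nat) (C : 'I_m -> set E)
    (hclosed : forall i, closed (C i)) (hconvex : forall i, convex_set (C i))
    (hne : \bigcap_i C i !=set0)
    (x0 : E) (alpha lambda : nat -> 'I_m -> R)
    (halpha : forall k i, 0 <= alpha k i < 2)
    (hlambda : forall k i, 0 <= lambda k i)
    (hsum : forall k, \sum_(i < m) lambda k i = 1)
    (x : nat -> E) (hx : projection_iterates C alpha lambda x0 x)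
    (hcontrol : remotest_control C alpha lambda x \/
                exists s, intermittent_control alpha lambda s) :
  (holder_error_bound C ->
     (exists2 l : E, (\bigcap_i C i) l & x @ \oo --> l) /\
     (exists2 p : R, 0 < p &
        (fun k => dist (x k) (\bigcap_i C i) : R^o)
          =O_\oo (fun k => k%:R `^ (- p) : R^o))) /\
  (forall gamma : R, 0 < gamma -> gamma <= 1 ->
     uniform_holder_error_bound C gamma ->
     (remotest_control C alpha lambda x -> rate_from C x gamma 2) /\
     (forall s, intermittent_control alpha lambda s ->
        rate_from C x gamma (2 * s))).
Proof.
have mono := fejer hnorm hclosed hconvex hne halpha hlambda hsum hx.
have range_x k : range x (x k) by exists k.
have bounded_x := bounded_iterates hne mono.
have [s [c [s0 c0 hdec]]] :
    exists s c, [/\ (0 < s)%N, 0 < c & block_decrease C x s c].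
  case: hcontrol => [h|[s h]].
    have [c c0 hc] := remotest_block_decrease
      hnorm hclosed hconvex hne halpha hlambda hsum hx h.
    by exists 1%N, c.
  have [c c0 hc] := intermittent_block_decrease
    hnorm hclosed hconvex hne halpha hlambda hsum hx h.
  by exists s, c; split=> //; case: h => _ [].
split=> [hbound|gamma g0 g1 hunif].
  have [gamma [g0 g1 hB]] := hbound _ bounded_x.
  have rate := block_rate hclosed hne mono g0 g1 s0 c0 hdec hB range_x.
  have [M [p [M0 p0 hp]]] := rate_from_power g0 g1 rate.
  split.
    by apply: (fejer_cvg hclosed hne mono); exact: power_dist_small M0 p0 hp.
  by exists p => //; exact: (power_bigO hne M0 hp).
have hB := hunif _ bounded_x.
split=> [h|s' h].
  have [c' c'0 hc] := remotest_block_decrease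
    hnorm hclosed hconvex hne halpha hlambda hsum hx h.
  exact: (block_rate hclosed hne mono g0 g1 (ltn0Sn 0) c'0 hc hB range_x).
have [c' c'0 hc] := intermittent_block_decrease
  hnorm hclosed hconvex hne halpha hlambda hsum hx h.
have s'0 : (0 < s')%N by case: h => _ [].
exact: (block_rate hclosed hne mono g0 g1 s'0 c'0 hc hB range_x).
Qed.
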